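(* Let $a,u$ be coprime positive integers with $a\neq u$. Then the polynomial $P_{a,u}(t)$ is irreducible in $\mathbb{Z}[t]$.
   Context: For positive integers $a,u$, put $\Delta=u^{2}-a^{2}$ and define the even monic polynomial $$P_{a,u}(t)=t^{8}+6\Delta\,t^{6}+(\Delta^{2}-2a^{2}u^{2})\,t^{4}-6\Delta\,a^{2}u^{2}\,t^{2}+a^{4}u^{4}\in\mathbb{Z}[t].$$ *)

(* Defs.v *)
From HB Require Import structures.
From mathcomp Require Import all_boot all_order all_algebra.
Set Implicit Arguments.
Unset Strict Implicit.
Unset Printing Implicit Defensive.
Import Order.TTheory GRing.Theory Num.Theory.
Local Open Scope ring_scope.

(* Irreducible elements of an integral domain. [irreducible_poly] is not what is
   wanted over int: its divisibility is pseudo-division, so it ignores constant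
   factors and describes irreducibility over the fraction field. *)
Definition irreducible_elt (R : idomainType) (x : R) : Prop :=
  [/\ x != 0, x \isn't a GRing.unit &
      forall y z : R, x = y * z ->
        y \is a GRing.unit \/ z \is a GRing.unit].

Definition cuboid_Delta (a u : nat) : int := u%:Z ^+ 2 - a%:Z ^+ 2.

Definition cuboid_poly (a u : nat) : {poly int} :=
  'X^8
  + (6 * cuboid_Delta a u)%:P * 'X^6
  + (cuboid_Delta a u ^+ 2 - 2 * a%:Z ^+ 2 * u%:Z ^+ 2)%:P * 'X^4
  - (6 * cuboid_Delta a u * a%:Z ^+ 2 * u%:Z ^+ 2)%:P * 'X^2
  + (a%:Z ^+ 4 * u%:Z ^+ 4)%:P.

(* Main.v *)
Require Import Defs.
From mathcomp Require Import all_boot all_order all_algebra.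
From mathcomp Require Import zify ring lra.

(** Put p = a u and D = u^2 - a^2. Then P(t) = Q(t^2) with
    Q(x) = (x^2 - p^2)^2 + 6 D x (x^2 - p^2) + D^2 x^2,
    and the proof has two halves: Q is irreducible over the rationals, and the
    substitution x = t^2 preserves irreducibility. As P is monic, its
    irreducibility over the rationals gives that over the integers.

    The substitution ([irreducible_comp_X2]). If g(t) = A(t^2) + t B(t^2) is a
    proper factor of Q(t^2), then g(t) g(-t) = G(t^2) with G = A^2 - x B^2,
    and, Q being irreducible, G is a constant multiple c Q of Q. At every
    x <= 0 the value of G is nonnegative, so evaluating at 0, where Q is p^4,
    gives c > 0. But Q(-u^2) = -4 D^2 u^4 < 0 while G(-u^2) >= 0.

    The quartic ([irreducible_cuboid_quartic]). A rational root of Q would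
    make 2 a square, as completing the square in x^2 - p^2 shows. Suppose now
    that Q = (x^2 + b x + c)(x^2 + d x + e). Since x -> -p^2/x permutes
    the roots of Q, comparing coefficients leaves two cases: c = e = -p^2, where
    the discriminant (b - d)^2 = 32 D^2 again makes 2 a square; or
    b p^2 = - d c, where elimination gives
    (c - e)^2 = D^2 (c + e + 34 p^2) and c e = p^4.
    With m = (c - e) / D and X = m / (2 p) the second case becomes
    (X^2 - 8)(X^2 - 9) = a nonzero rational square. Writing X = r / s in
    lowest terms, the two factors r^2 - 8 s^2 and r^2 - 9 s^2 are coprime, so
    they are squares up to a common sign. The negative sign is impossible
    modulo powers of 2, and the positive one says that B^2 + s^2 and
    B^2 + 9 s^2 are both squares.

    The last system has no solution in positive integers
    ([no_concordant_1_9]), by infinite descent on s. It corresponds to an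
    elliptic curve of rank 0, and the descent is a two-step one: factoring
    8 s^2 as a difference of squares leads to coprime x, y for which y^2 - x^2
    and y^2 - 4 x^2 are squares, and the same operation on that system
    ([descent_1_4]) leads back to the first one with a smaller s. *)

(** * Squares and coprime products *)

Lemma odd_sqr_mod8 n : odd n -> exists k, n ^ 2 = 8 * k + 1.
Proof.
move=> on; have [k ->] : exists k, n = 2 * k + 1 by exists n./2; lia.
have [j Hj] : exists j, k * (k + 1) = 2 * j.
  exists (k * (k + 1))./2.
  have : ~~ odd (k * (k + 1)) by rewrite oddM oddD; case: odd.
  lia.
by exists j; nia.
Qed.

Lemma even_sqr_mod4 n : ~~ odd n -> exists k, n ^ 2 = 4 * k.
Proof. by move=> en; exists (n./2 ^ 2); have := odd_double_half n; nia. Qed.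

Lemma no_prime_coprime m n :
  (forall p, prime p -> p %| m -> p %| n -> False) -> coprime m n.
Proof.
move=> H; rewrite /coprime; case: (posnP (gcdn m n)) => [/eqP|g0].
  rewrite -dvd0n dvdn_gcd !dvd0n => /andP[/eqP m0 /eqP n0].
  by case: (H 2); rewrite ?m0 ?n0.
case: (ltngtP (gcdn m n) 1) => // g1; first lia.
have := pdiv_dvd (gcdn m n); rewrite dvdn_gcd => /andP[pm pn].
by case: (H _ (pdiv_prime g1) pm pn).
Qed.

Lemma coprime_no_prime m n p :
  coprime m n -> prime p -> p %| m -> p %| n -> False.
Proof.
move=> cmn pp pm pn; have : p %| gcdn m n by rewrite dvdn_gcd pm.
by rewrite (eqP cmn) dvdn1 => /eqP p1; move: pp; rewrite p1.
Qed.

Lemma coprime_mul_eq_sqr x y z : coprime x y -> x * y = z ^ 2 ->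
  (exists d, x = d ^ 2) /\ (exists e, y = e ^ 2).
Proof.
have key m n : coprime m n -> m * n = z ^ 2 -> exists d, m = d ^ 2.
  move=> cmn; case: (posnP m) => [->|m0]; first by exists 0.
  have g0 : 0 < gcdn m z by rewrite gcdn_gt0 m0.
  set g := gcdn m z in g0 *.
  have [m' Em] : exists m', m = g * m'.
    by have /dvdnP[k ->] := dvdn_gcdl m z; exists k; rewrite mulnC.
  have [z' Ez] : exists z', z = g * z'.
    by have /dvdnP[k ->] := dvdn_gcdr m z; exists k; rewrite mulnC.
  have cmz : coprime m' z'.
    rewrite /coprime; apply/eqP/eqP; rewrite -(eqn_pmul2l g0) muln_gcdr -Em -Ez.
    by rewrite muln1.
  rewrite {1}Em Ez => e.
  have {}e : m' * n = g * z' ^ 2.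
    by apply/eqP; rewrite -(eqn_pmul2l g0); apply/eqP; nia.
  exists g; rewrite {1}Em; suff -> : m' = g by rewrite mulnn.
  apply/eqP; rewrite eqn_dvd; apply/andP; split.
    have : m' %| g * z' ^ 2 by rewrite -e dvdn_mulr.
    by rewrite Gauss_dvdl // coprimeXr.
  have : g %| m' * n by rewrite e dvdn_mulr.
  by rewrite Gauss_dvdl //; apply: coprime_dvdl cmn; rewrite Em dvdn_mulr.
move=> cxy e; split; first exact: (key x y).
by apply: (key y x); rewrite 1?coprime_sym // mulnC.
Qed.

(** If q divides both factors, dividing each of them by q leaves coprime numbers
    whose product is still a square. *)
Lemma gcd_prime_mul_eq_sqr q x y z :
  prime q -> 0 < z -> gcdn x y %| q -> x * y = z ^ 2 ->
  exists d e, (x = d ^ 2 /\ y = e ^ 2) \/ (x = q * d ^ 2 /\ y = q * e ^ 2).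
Proof.
move=> pq z0 /(primeP pq).2/orP[/eqP g1|/eqP gq] e.
  have [[a ->] [b ->]] := coprime_mul_eq_sqr _ _ _ (introT eqP g1) e.
  by exists a, b; left.
have q0 := prime_gt0 pq.
have /dvdnP[x' Ex] : q %| x by rewrite -gq dvdn_gcdl.
have /dvdnP[y' Ey] : q %| y by rewrite -gq dvdn_gcdr.
have c' : coprime x' y'.
  by rewrite /coprime -(eqn_pmul2r q0) muln_gcdl -Ex -Ey gq mul1n.
have : q %| z ^ 2 by rewrite -e Ex dvdn_mulr // dvdn_mull.
rewrite Euclid_dvdX // andbT => /dvdnP[z' Ez].
have e' : x' * y' = z' ^ 2.
  have qq0 : 0 < q * q by rewrite muln_gt0 q0.
  by apply/eqP; rewrite -(eqn_pmul2l qq0); apply/eqP; nia.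
have [[a Ea] [b Eb]] := coprime_mul_eq_sqr _ _ _ c' e'.
by exists a, b; right; rewrite Ex Ey Ea Eb !(mulnC q).
Qed.

(** The odd power of q sits in exactly one of the coprime factors. *)
Lemma coprime_mul_eq_prime_sqr q x y z :
  prime q -> coprime x y -> x * y = q * z ^ 2 ->
  exists d e, z = d * e /\
    ((x = q * d ^ 2 /\ y = e ^ 2) \/ (x = e ^ 2 /\ y = q * d ^ 2)).
Proof.
move=> pq; have q0 := prime_gt0 pq.
have key m n : coprime m n -> m * n = q * z ^ 2 -> q %| m ->
    exists d e, z = d * e /\ (m = q * d ^ 2 /\ n = e ^ 2).
  move=> cmn e /dvdnP[m' Em].
  have e' : m' * n = z ^ 2.
    by apply/eqP; rewrite -(eqn_pmul2l q0); apply/eqP; nia.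
  have c' : coprime m' n by apply: coprime_dvdl cmn; rewrite Em dvdn_mulr.
  have [[a Ea] [b Eb]] := coprime_mul_eq_sqr _ _ _ c' e'.
  exists a, b; split; last by rewrite Em Ea mulnC.
  by apply: sqrn_inj => /=; rewrite -e' Ea Eb expnMn.
move=> cxy e; have : q %| x * y by rewrite e dvdn_mulr.
rewrite Euclid_dvdM // => /orP[qx|qy].
  have [a [b [-> H]]] := key x y cxy e qx; by exists a, b; split=> //; left.
have cyx : coprime y x by rewrite coprime_sym.
have e' : y * x = q * z ^ 2 by rewrite mulnC.
have [a [b [-> [H1 H2]]]] := key y x cyx e' qy.
by exists a, b; split=> //; right.
Qed.

(** * The concordant system for 1 and 9 *)

(** Linear arithmetic can decide congruences between squares once the residue of
    each square is written out. *)
Ltac sq_parity n :=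
  let H := fresh "par" in let k := fresh "k" in let e := fresh "sq" in
  case: (boolP (odd n)) =>
    [/[dup] H /odd_sqr_mod8[k e] | /[dup] H /even_sqr_mod4[k e]].

Lemma odd_sqr_neq_3sqr_4sqr x y E :
  odd y -> y ^ 2 = 3 * E ^ 2 + 4 * x ^ 2 -> False.
Proof. by move=> /odd_sqr_mod8[k ->]; sq_parity E; lia. Qed.

Lemma four_sqr_neq_sqr_odd_sqr x y E :
  odd y -> 4 * x ^ 2 = E ^ 2 + y ^ 2 -> False.
Proof. by move=> /odd_sqr_mod8[k ->]; sq_parity E; lia. Qed.

Lemma odd_sqr_4sqr_odd D y E : odd y -> y ^ 2 + 4 * D ^ 2 = E ^ 2 -> odd E.
Proof. by move=> /odd_sqr_mod8[k ->]; sq_parity E; lia. Qed.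

(** Subtracting gives D^2 - E^2 = 3 x^2, where D and E are odd and x is even. So
    the coprime numbers (D - E)/2 and (D + E)/2 are 3 z^2 and w^2 in some order,
    with x = 2 z w and D = 3 z^2 + w^2, and y^2 = D^2 + x^2 factors as
    (w^2 + z^2)(w^2 + 9 z^2), with coprime factors. *)
Lemma descent_1_4 x y D E : coprime x y -> odd y -> 0 < x -> 0 < E ->
  D ^ 2 + x ^ 2 = y ^ 2 -> E ^ 2 + 4 * x ^ 2 = y ^ 2 ->
  exists z w, [/\ 0 < z, 0 < w & coprime w z] /\ z < x /\
    (exists A, w ^ 2 + z ^ 2 = A ^ 2) /\ (exists r, w ^ 2 + 9 * z ^ 2 = r ^ 2).
Proof.
move=> cxy oy x0 E0 eD eE.
have [ky ey] := odd_sqr_mod8 _ oy.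
have [oE [oD [x' ex]]] : odd E /\ odd D /\ exists x', x = 2 * x'.
  sq_parity x; sq_parity E; sq_parity D; try lia.
  by split=> //; split=> //; exists x./2; lia.
(* The square of a common prime would divide 3 x^2 and 3 y^2, hence 3. *)
have cDE : coprime D E.
  apply: no_prime_coprime => p pp pD pE.
  have d1 : p ^ 2 %| 3 * y ^ 2.
    have -> : 3 * y ^ 2 = 4 * D ^ 2 - E ^ 2 by lia.
    by apply: dvdn_sub; rewrite 1?[_ %| 4 * _]dvdn_mull ?dvdn_exp2r.
  have d2 : p ^ 2 %| 3 * x ^ 2.
    have -> : 3 * x ^ 2 = D ^ 2 - E ^ 2 by lia.
    by apply: dvdn_sub; rewrite dvdn_exp2r.
  have : p ^ 2 %| gcdn (3 * x ^ 2) (3 * y ^ 2) by rewrite dvdn_gcd d1 d2.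
  rewrite -muln_gcdr.
  have -> : gcdn (x ^ 2) (y ^ 2) = 1.
    by apply/eqP; rewrite -/(coprime _ _) coprime_pexpl // coprime_pexpr.
  move/dvdn_leq => /(_ isT); apply/negP; rewrite -ltnNge.
  by rewrite (@leq_trans (2 ^ 2)) // leq_sqr prime_gt1.
have DE : E < D by rewrite -ltn_sqr; lia.
pose M := (D - E)./2; pose N := (D + E)./2.
have eM : D = M + N by rewrite /M /N; lia.
have eN : N = E + M by rewrite /M /N; lia.
have M0 : 0 < M by rewrite /M; lia.
clearbody M N.
have cMN : coprime M N.
  apply: no_prime_coprime => p pp pM pN.
  apply: (coprime_no_prime _ _ _ cDE pp); rewrite ?eM ?dvdn_add //.
  by rewrite -(dvdn_addl _ pM) -eN.
have eMN : M * N = 3 * x' ^ 2 by move: eD eE; rewrite eM eN ex; lia.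
have [z [w [ezw H]]] := coprime_mul_eq_prime_sqr 3 M N x' isT cMN eMN.
have z0 : 0 < z by case: z ezw H => //; lia.
have w0 : 0 < w by case: w ezw H => //; lia.
have eDD : D = 3 * z ^ 2 + w ^ 2 by rewrite eM; lia.
have cwz : coprime w z.
  apply: no_prime_coprime => p pp pw pz.
  by apply: (coprime_no_prime _ _ _ cMN pp); case: H => -[e1 e2];
     rewrite ?e1 ?e2 ?dvdn_mull // -mulnn dvdn_mulr.
have eY : (w ^ 2 + z ^ 2) * (w ^ 2 + 9 * z ^ 2) = y ^ 2.
  by rewrite -eD ex ezw eDD; lia.
(* The factors differ by 8 z^2, and 2 is excluded because D is odd. *)
have cY : coprime (w ^ 2 + z ^ 2) (w ^ 2 + 9 * z ^ 2).
  apply: no_prime_coprime => p pp p1 p2.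
  have p8 : p %| 8 * z ^ 2.
    have -> : 8 * z ^ 2 = (w ^ 2 + 9 * z ^ 2) - (w ^ 2 + z ^ 2) by lia.
    by rewrite dvdn_sub.
  have p2' : p = 2 \/ p %| z.
    move: p8; rewrite Euclid_dvdM // Euclid_dvdX // andbT.
    case/orP => [|->]; last by right.
    rewrite (_ : 8 = 2 ^ 3) // Euclid_dvdX // andbT dvdn_prime2 //.
    by move/eqP; left.
  case: p2' => [p2'|pz].
    move: oD p1; rewrite eDD p2' dvdn2; lia.
  have : p %| w ^ 2 by move: p1; rewrite dvdn_addl // -mulnn dvdn_mulr.
  rewrite Euclid_dvdX // andbT => pw.
  exact: (coprime_no_prime _ _ _ cwz pp pw pz).
have [HA HB] := coprime_mul_eq_sqr _ _ _ cY eY.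
exists z, w; split=> //; split=> //.
have : z * 1 <= z * w by rewrite leq_mul.
lia.
Qed.

(** Infinite descent on s. Both A and r are odd, and r^2 - A^2 = 8 s^2 gives
    s = x y with A = +-(y^2 - 2 x^2), so B^2 = (y^2 - x^2)(y^2 - 4 x^2). The gcd
    of the factors divides 3. Congruences modulo 4 leave two cases: both
    factors are squares, or both are -3 times a square. In the second case, with
    factors -3 D^2 and -3 E^2, one has E^2 - D^2 = x^2 and E^2 - 4 D^2 = y^2, so
    (D, E) takes the place of (x, y); in either case [descent_1_4] applies. *)
Lemma no_concordant_1_9 s B A r : 0 < s -> 0 < B -> coprime B s ->
  B ^ 2 + s ^ 2 = A ^ 2 -> B ^ 2 + 9 * s ^ 2 = r ^ 2 -> False.
Proof.
have [n] := ubnP s; elim: n s B A r => // n IH s B A r sn s0 B0 cBs eA er.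
have descend x y D E : coprime x y -> odd y -> 0 < x -> 0 < E -> x <= s ->
  D ^ 2 + x ^ 2 = y ^ 2 -> E ^ 2 + 4 * x ^ 2 = y ^ 2 -> False.
  move=> cxy oy x0 E0 xs eD eE.
  have [z [w [[z0 w0 cwz] [zx [[A' eA'] [r' er']]]]]] :=
    descent_1_4 x y D E cxy oy x0 E0 eD eE.
  by apply: (IH z w A' r') => //; lia.
have [oA odr] : odd A /\ odd r.
  have nBs : odd B \/ odd s.
    apply/orP; apply: contraT; rewrite negb_or => /andP[eB es]; exfalso.
    by apply: (coprime_no_prime _ _ 2 cBs); rewrite // dvdn2.
  by sq_parity s; sq_parity B; sq_parity A; sq_parity r; lia.
have cAs : coprime A s.
  apply: no_prime_coprime => p pp pA ps.
  apply: (coprime_no_prime _ _ p cBs) => //.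
  have : p %| B ^ 2 by rewrite -(dvdn_addl (n := s ^ 2)) ?eA -?mulnn dvdn_mulr.
  by rewrite Euclid_dvdX // andbT.
have Ar : A < r by rewrite -ltn_sqr; lia.
pose M := (r - A)./2; pose N := (r + A)./2.
have eN : N = A + M by rewrite /M /N; lia.
have er' : r = A + 2 * M by rewrite /M; lia.
have M0 : 0 < M by rewrite /M; lia.
clearbody M N.
have eMN : M * N = 2 * s ^ 2 by move: er; rewrite er' eN; lia.
have cMN : coprime M N.
  apply: no_prime_coprime => p pp pM pN.
  have pA : p %| A by rewrite -(dvdn_addl _ pM) -eN.
  have : p ^ 2 %| 2 * s ^ 2 by rewrite -eMN -mulnn dvdn_mul.
  rewrite mulnC Gauss_dvdr; last first.
    by rewrite coprimeXl // coprimeXr // (coprime_dvdl pA).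
  move/dvdn_leq => /(_ isT); apply/negP; rewrite -ltnNge.
  by rewrite (@leq_trans (2 ^ 2)) // leq_sqr prime_gt1.
have [x [y [es H]]] := coprime_mul_eq_prime_sqr 2 M N s isT cMN eMN.
have x0 : 0 < x by case: x es H => //; lia.
have y0 : 0 < y by case: y es H => //; lia.
have oy : odd y.
  apply: contraT => /even_sqr_mod4[k ek]; lia.
have cxy : coprime x y.
  apply: no_prime_coprime => p pp px py.
  by apply: (coprime_no_prime _ _ _ cMN pp); case: H => -[e1 e2];
     rewrite ?e1 ?e2 ?dvdn_mull // -mulnn dvdn_mulr.
have xs : x <= s by rewrite es leq_pmulr.
have [ky ey] := odd_sqr_mod8 _ oy.
have eB : B ^ 2 + x ^ 2 * y ^ 2 = A ^ 2 by rewrite -eA es expnMn.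
have eAxy : A + 2 * x ^ 2 = y ^ 2 \/ A + y ^ 2 = 2 * x ^ 2 by lia.
have gcd3 f g : y ^ 2 = f + x ^ 2 \/ x ^ 2 = f + y ^ 2 ->
    f = g + 3 * x ^ 2 \/ g = f + 3 * x ^ 2 -> gcdn f g %| 3.
  move=> Hf Hg; have [df dg] := (dvdn_gcdl f g, dvdn_gcdr f g).
  have dx : gcdn f g %| 3 * x ^ 2.
    case: Hg => Hg.
      by rewrite -(dvdn_addr _ dg) -Hg.
    by rewrite -(dvdn_addr _ df) -Hg.
  rewrite -(@Gauss_dvdl _ 3 (x ^ 2)) //.
  apply: no_prime_coprime => p pp /dvdn_trans pd px2.
  have pf := pd _ df.
  have px : p %| x by move: px2; rewrite Euclid_dvdX // andbT.
  have : p %| y ^ 2.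
    by case: Hf => Hf; [rewrite Hf dvdn_add | rewrite -(dvdn_addr _ pf) -Hf].
  by rewrite Euclid_dvdX // andbT; apply: (coprime_no_prime _ _ _ cxy pp px).
have [yx|xy] := ltnP (4 * x ^ 2) (y ^ 2).
  have [g eg] : exists g, y ^ 2 = g + 4 * x ^ 2.
    by exists (y ^ 2 - 4 * x ^ 2); lia.
  have ef : y ^ 2 = (g + 3 * x ^ 2) + x ^ 2 by lia.
  have eA' : A = g + 2 * x ^ 2 by clear eB; lia.
  have g0 : 0 < g by lia.
  have efg : (g + 3 * x ^ 2) * g = B ^ 2 by move: eB; rewrite eA' eg; lia.
  have g3 : gcdn (g + 3 * x ^ 2) g %| 3 by apply: gcd3; left.
  have [D [E [[eD eE]|[eD eE]]]] := gcd_prime_mul_eq_sqr 3 _ g B isT B0 g3 efg.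
    have E0 : 0 < E by rewrite -sqrn_gt0 -eE.
    by apply: (descend x y D E) => //; rewrite -1?eD -1?eE.
  have e4 : y ^ 2 = 3 * E ^ 2 + 4 * x ^ 2 by rewrite -eE.
  exact: (odd_sqr_neq_3sqr_4sqr _ _ _ oy e4).
have {}xy : y ^ 2 < x ^ 2.
  rewrite ltnNge; apply/negP => yx; have B2 : 0 < B ^ 2 by rewrite sqrn_gt0.
  case: eAxy => eAxy; move: eB.
    have : A * (A + x ^ 2) <= 2 * x ^ 2 * (A + x ^ 2) by rewrite leq_mul2r; lia.
    by rewrite -eAxy; lia.
  have -> : y ^ 2 = 2 * x ^ 2 - A by lia.
  have : A * (A + 2 * x ^ 2) <= x ^ 2 * (A + 2 * x ^ 2).
    by rewrite leq_mul2r; lia.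
  by rewrite mulnBr; lia.
have [f ef] : exists f, x ^ 2 = f + y ^ 2 by exists (x ^ 2 - y ^ 2); lia.
have f0 : 0 < f by lia.
have eA' : A = y ^ 2 + 2 * f by clear eB; lia.
have efg : f * (f + 3 * x ^ 2) = B ^ 2 by move: eB; rewrite eA' ef; lia.
have g3 : gcdn f (f + 3 * x ^ 2) %| 3 by apply: gcd3; right.
have [D [E [[eD eE]|[eD eE]]]] := gcd_prime_mul_eq_sqr 3 f _ B isT B0 g3 efg;
  clear eB efg eMN eA'.
  have e4 : 4 * x ^ 2 = E ^ 2 + y ^ 2 by rewrite -eE; lia.
  exact: (four_sqr_neq_sqr_odd_sqr _ _ _ oy e4).
have D0 : 0 < D by rewrite -sqrn_gt0; lia.
have E0 : 0 < E by rewrite -sqrn_gt0; lia.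
have eDE : D ^ 2 + x ^ 2 = E ^ 2 by lia.
have eDE' : y ^ 2 + 4 * D ^ 2 = E ^ 2 by lia.
have Ds : D <= s by apply: leq_trans xs; rewrite -leq_sqr; lia.
apply: (descend D E x y) => //.
- apply: no_prime_coprime => p pp pD pE.
  have sD : p %| D ^ 2 by rewrite -mulnn dvdn_mulr.
  have sE : p %| E ^ 2 by rewrite -mulnn dvdn_mulr.
  have px : p %| x ^ 2 by rewrite -(dvdn_addr _ sD) eDE.
  have py : p %| y ^ 2 by rewrite -(dvdn_addl _ (dvdn_mull 4 sD)) eDE'.
  move: px py; rewrite !Euclid_dvdX // !andbT.
  exact: (coprime_no_prime _ _ _ cxy pp).
- exact: (odd_sqr_4sqr_odd _ _ _ oy eDE').
- by rewrite addnC.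
Qed.

(** * Rational solutions of the quartic equation *)

Import Order.TTheory GRing.Theory Num.Theory.
Local Open Scope ring_scope.

(** The factors differ by s^2 and r is prime to s, so they are coprime and, up
    to a common sign, squares. If both are positive, their roots A and B satisfy
    B^2 + s^2 = A^2 and B^2 + 9 s^2 = r^2; if both are negative,
    A^2 + r^2 = 8 s^2 and B^2 + r^2 = 9 s^2, which fails modulo 16 since r and s
    are not both even. *)
Lemma sqr8_sqr9_nat r s k : (0 < s)%N -> coprime r s ->
  (r%:Z ^+ 2 - 8 * s%:Z ^+ 2) * (r%:Z ^+ 2 - 9 * s%:Z ^+ 2) = k ^+ 2 -> k = 0.
Proof.
move=> s0 crs e; apply/eqP/negPn/negP => k0.
pose K := `|k|%N; have K0 : (0 < K)%N by rewrite /K; lia.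
have eK : k ^+ 2 = K%:Z ^+ 2 by rewrite /K; lia.
move: e; rewrite {k0}eK; move: K K0 => {}k k0 e.
have gcd1 f g : (g + s ^ 2 = f \/ f + s ^ 2 = g)%N ->
    (r ^ 2 = f + 8 * s ^ 2 \/ 8 * s ^ 2 = f + r ^ 2)%N -> coprime f g.
  move=> Hg Hf; apply: no_prime_coprime => p pp pf pg.
  have ps : (p %| s ^ 2)%N.
    case: Hg => Hg; first by rewrite -(dvdn_addr _ pg) Hg.
    by rewrite -(dvdn_addr _ pf) Hg.
  have pr : (p %| r ^ 2)%N.
    case: Hf => Hf; first by rewrite Hf dvdn_add // dvdn_mull.
    by rewrite -(dvdn_addr _ pf) -Hf dvdn_mull.
  move: ps pr; rewrite !Euclid_dvdX // !andbT => ps pr.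
  exact: coprime_no_prime crs pp pr ps.
have s2 : (0 < s ^ 2)%N by rewrite sqrn_gt0.
have k2 : (0 < k ^ 2)%N by rewrite sqrn_gt0.
case: (ltnP (9 * s ^ 2) (r ^ 2)) => [rs|rs].
  have [g eg] : exists g, (r ^ 2 = g + 9 * s ^ 2)%N.
    by exists (r ^ 2 - 9 * s ^ 2)%N; lia.
  have efg : ((g + s ^ 2) * g = k ^ 2)%N.
    have eg' : r%:Z ^+ 2 = g%:Z + 9 * s%:Z ^+ 2 by lia.
    by move: e; rewrite eg'; clear; lia.
  have c : coprime (g + s ^ 2) g by apply: gcd1; lia.
  have [[A eA] [B eB]] := coprime_mul_eq_sqr _ _ _ c efg.
  have B0 : (0 < B)%N by rewrite -sqrn_gt0 -eB; lia.
  apply: (no_concordant_1_9 s B A r) => //; rewrite -?eA -?eB //.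
  rewrite -(@coprime_pexpl 2) // -(@coprime_pexpr 2) // -eB.
  by move: c; rewrite /coprime gcdnC gcdnDl.
have rs' : (r ^ 2 < 8 * s ^ 2)%N.
  rewrite ltnNge; apply/negP => rs'.
  have : (r%:Z ^+ 2 - 8 * s%:Z ^+ 2) * (r%:Z ^+ 2 - 9 * s%:Z ^+ 2) <= 0.
    by apply: mulr_ge0_le0; lia.
  by rewrite e; lia.
have [f ef] : exists f, (8 * s ^ 2 = f + r ^ 2)%N.
  by exists (8 * s ^ 2 - r ^ 2)%N; lia.
have efg : (f * (f + s ^ 2) = k ^ 2)%N.
  have eg' : r%:Z ^+ 2 = 8 * s%:Z ^+ 2 - f%:Z by lia.
  by move: e; rewrite eg'; clear; lia.
have c : coprime f (f + s ^ 2) by apply: gcd1; lia.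
have [[A eA] [B eB]] := coprime_mul_eq_sqr _ _ _ c efg.
have nrs : odd r \/ odd s.
  apply/orP; apply: contraT; rewrite negb_or => /andP[er es]; exfalso.
  by apply: (coprime_no_prime _ _ 2 crs); rewrite // dvdn2.
clear - ef eA eB nrs; subst f.
have er : ~~ odd r.
  apply/negP => or; sq_parity r; sq_parity A; lia.
have os : odd s by case: nrs => //; rewrite (negbTE er).
have [j ej] : exists j, r = (2 * j)%N by exists r./2; lia.
have [i ei] : exists i, A = (2 * i)%N by sq_parity A; [lia | exists A./2; lia].
have [l el] := odd_sqr_mod8 _ os; subst r A; clear nrs os er.
have oj : odd j by clear eB; sq_parity j; sq_parity i; lia.
by have [m em] := odd_sqr_mod8 _ oj; sq_parity B; lia.
Qed.

(** Clearing denominators yields an integer that is the square of a rational,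
    hence of an integer. *)
Lemma sqr8_sqr9_rat (X w : rat) : (X ^+ 2 - 8) * (X ^+ 2 - 9) = w ^+ 2 -> w = 0.
Proof.
move=> e; pose r := `|numq X|%N; pose s := `|denq X|%N.
have s0 : (0 < s)%N by rewrite absz_gt0 denq_neq0.
have es : (s%:Z)%:~R = (denq X)%:~R :> rat by rewrite /s absz_denq.
have er : (r%:Z ^+ 2)%:~R = (numq X)%:~R ^+ 2 :> rat.
  by rewrite abszE real_normK ?num_real ?rmorphXn.
pose z : rat := w * s%:~R ^+ 2.
have s0' : s%:~R != 0 :> rat by rewrite es intr_eq0 denq_neq0.
pose F : int := (r%:Z ^+ 2 - 8 * s%:Z ^+ 2) * (r%:Z ^+ 2 - 9 * s%:Z ^+ 2).
have eF : F%:~R = z ^+ 2.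
  have eX : (r%:Z ^+ 2)%:~R = X ^+ 2 * s%:~R ^+ 2.
    by rewrite er -{2}(divq_num_den X) expr_div_n -es divfK // expf_neq0.
  move: eX; rewrite rmorphXn /= => eX.
  rewrite /F /z exprMn -e !(rmorphM, rmorphB, rmorphXn) /=.
  rewrite -!expr2 eX; ring.
have : F = numq z ^+ 2 /\ denq z = 1.
  have ez : F * denq z ^+ 2 = numq z ^+ 2.
    apply: (@intr_inj rat); rewrite rmorphM !rmorphXn /= eF -{1}(divq_num_den z).
    by rewrite expr_div_n divfK // expf_neq0 // intr_eq0 denq_neq0.
  suff d1 : denq z = 1 by rewrite -ez d1 expr1n mulr1.
  have : (`|denq z| ^ 2 %| `|numq z| ^ 2)%N.
    by rewrite -!abszX -ez abszM dvdn_mull.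
  rewrite dvdn_pexp2r // => dd; have := coprime_num_den z.
  rewrite /coprime gcdnC (gcdn_idPl dd) => /eqP d1.
  by rewrite -absz_denq d1.
move=> [eFz dz].
have nz0 := sqr8_sqr9_nat r s (numq z) s0 (coprime_num_den X) eFz.
have : z = 0 by rewrite -(divq_num_den z) nz0 mul0r.
by move/eqP; rewrite mulf_eq0 expf_eq0 (negbTE s0') orbF => /eqP.
Qed.

(** Irrationality of the square root of 2, in the form in which a nonsquare
    discriminant is met below. *)
Lemma sqr_eq_double_sqr_rat (x y : rat) : x ^+ 2 = 2 * y ^+ 2 -> y = 0.
Proof.
move=> e; apply: contraTeq isT => y0 /=; pose z := x / y.
have ez : z ^+ 2 = 2 by rewrite expr_div_n e mulfK // expf_neq0.
have : numq z ^+ 2 = 2 * denq z ^+ 2.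
  apply: (@intr_inj rat); rewrite [in RHS]rmorphM !rmorphXn /= -[2%:~R]ez.
  rewrite -{2}(divq_num_den z).
  by rewrite expr_div_n divfK // expf_neq0 // intr_eq0 denq_neq0.
move/(congr1 absz); rewrite abszM !abszX => /(congr1 (logn 2)).
have d0 : (0 < `|denq z|)%N by rewrite absz_gt0 denq_neq0.
rewrite lognM ?expn_gt0 ?d0 // !lognX (_ : logn 2 `|2 : int| = 1%N) //; lia.
Qed.

(** * Irreducibility criteria for polynomials *)

Lemma irreducible_quartic {F : fieldType} (q0 q1 q2 q3 : F) :
  let p := 'X^4 + q3 *: 'X^3 + q2 *: 'X^2 + q1 *: 'X + q0%:P in
  (forall x, x ^+ 4 + q3 * x ^+ 3 + q2 * x ^+ 2 + q1 * x + q0 <> 0) ->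
  (forall b c d e, b + d = q3 -> c + e + b * d = q2 ->
     b * e + c * d = q1 -> c * e <> q0) ->
  irreducible_poly p.
Proof.
move=> p nroot' nquad.
have nroot x : ~~ root p x.
  apply/negP => /rootP px; apply: (nroot' x); rewrite -[RHS]px.
  by rewrite !(hornerD, hornerZ, hornerXn, hornerX, hornerC).
have pE : p = Poly [:: q0; q1; q2; q3; 1].
  by rewrite /= !cons_poly_def /p -!mul_polyC; ring.
have sp : size p = 5%N by rewrite pE (@PolyK _ 0) //= oner_neq0.
have cp i : p`_i = [:: q0; q1; q2; q3; 1]`_i by rewrite pE coef_Poly.
have p0 : p != 0 by rewrite -size_poly_eq0 sp.
split=> [|q sq1 /[dup] qp /dvdpP[r er]]; first by rewrite sp.
have /andP[r0 q0'] : (r != 0) && (q != 0) by rewrite -negb_or -mulf_eq0 -er.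
have srq : (size r + size q = 6)%N.
  have : size p = (size r + size q).-1 by rewrite er size_mul.
  by rewrite sp; have := polySpred r0; lia.
have root_lin (t : {poly F}) : size t = 2%N -> t %| p -> False.
  move=> st /dvdpP[t' et].
  have [x tx] := poly2_root st.
  by have := nroot x; rewrite et rootM tx orbT.
have rp : r %| p by rewrite er dvdp_mulr.
have sq0 : (0 < size q)%N by rewrite lt0n size_poly_eq0.
have sr0 : (0 < size r)%N by rewrite lt0n size_poly_eq0.
rewrite -dvdp_size_eqp // sp; apply/eqP.
have : [\/ size q = 2, size q = 3, size q = 4 | size q = 5]%N.
  have : (2 <= size q <= 5)%N by move/eqP: sq1; lia.
  by case: (size q) => [|[|[|[|[|[|]]]]]] //=; constructor.
case=> // sq.
- by case: (root_lin q).
- exfalso; have sr : size r = 3%N by lia.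
  have c i : p`_i = \sum_(j < i.+1) r`_j * q`_(i - j) by rewrite er coefM.
  have r3 i : (2 < i)%N -> r`_i = 0 by move=> i2; rewrite nth_default ?sr.
  have q3' i : (2 < i)%N -> q`_i = 0 by move=> i2; rewrite nth_default ?sq.
  move: (c 0%N) (c 1%N) (c 2%N) (c 3%N) (c 4%N); rewrite !cp !big_ord_recr !big_ord0 /=.
  rewrite ?subn0 ?subnn !subSS ?subn0.
  rewrite !(r3 3%N, r3 4%N, q3' 3%N, q3' 4%N) //.
  move: (r`_0) (r`_1) (r`_2) (q`_0) (q`_1) (q`_2) => r'0 r'1 r'2 q'0 q'1 q'2.
  rewrite !mulr0 !mul0r !addr0 !add0r => c0 c1 c2 c3 c4.
  apply: (nquad (r'1 * q'2) (r'0 * q'2) (r'2 * q'1) (r'2 * q'0)).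
  - by [].
  - rewrite c2 -[r'1 * q'1]mulr1 c4; ring.
  - rewrite c1 -[RHS]mulr1 c4; ring.
  - rewrite c0 -[RHS]mulr1 c4; ring.
- by case: (root_lin r) => //; lia.
Qed.

(** The polynomial G with G(t^2) = p(t) p(-t): the norm of p for the quadratic
    extension of the ring of polynomials in t^2 generated by t. *)
Definition even_odd_norm {R : nzRingType} (p : {poly R}) : {poly R} :=
  even_poly p ^+ 2 - 'X * odd_poly p ^+ 2.

Lemma even_odd_normE {R : comNzRingType} (p : {poly R}) :
  even_odd_norm p \Po 'X^2 = p * (p \Po (- 'X)).
Proof.
rewrite /even_odd_norm -{3 4}(poly_even_odd p) comp_polyB.
rewrite (expr2 (even_poly p)) (expr2 (odd_poly p)) !comp_polyM.
rewrite comp_polyX [X in _ = _ * X]comp_polyD comp_polyM -!comp_polyA comp_polyX.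
by rewrite comp_Xn_poly sqrrN; ring.
Qed.

Lemma comp_X2_inj {R : idomainType} (p q : {poly R}) :
  p \Po 'X^2 = q \Po 'X^2 -> p = q.
Proof.
move=> e; apply/eqP; rewrite -subr_eq0 -(@comp_poly_eq0 _ _ 'X^2) ?size_polyXn //.
by rewrite comp_polyB e subrr.
Qed.

(** For a factorization Q(t^2) = h(t) g(t), the norms of g and h have product
    Q^2. If neither g nor h is constant, then Q divides both norms, so the norm
    of g is a constant multiple c Q. At -v <= 0 this norm takes the nonnegative
    value A(-v)^2 + v B(-v)^2, at 0 the value A(0)^2; the first forces c <= 0
    and the second c > 0. *)
Lemma irreducible_comp_X2 {R : realFieldType} (Q : {poly R}) (v : R) :
  irreducible_poly Q -> 0 < Q.[0] -> 0 <= v -> Q.[- v] < 0 ->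
  irreducible_poly (Q \Po 'X^2).
Proof.
move=> irrQ Q0 v0 Qv; have Qn0 := irredp_neq0 irrQ; split=> [|g g1].
  rewrite -subn_gt0 subn1 size_comp_poly size_polyXn muln_gt0 -subn1 subn_gt0.
  by rewrite irrQ.1.
case/dvdpP => h eP.
have normM : even_odd_norm g * even_odd_norm h = Q ^+ 2.
  apply: comp_X2_inj; rewrite comp_polyM !even_odd_normE expr2 comp_polyM.
  have e' : (Q \Po 'X^2) = (h \Po (- 'X)) * (g \Po (- 'X)).
    by rewrite -comp_polyM -eP -comp_polyA comp_Xn_poly sqrrN.
  by rewrite {1}eP e'; ring.
have dich t : even_odd_norm t %| Q ^+ 2 -> size t = 1%N \/ Q %| even_odd_norm t.
  move=> tQ; case: (boolP (Q %| even_odd_norm t)) => [|nd]; [by right | left].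
  have : even_odd_norm t %| 1.
    rewrite -(@Gauss_dvdpr _ 1 (Q ^+ 2)) ?mulr1 //.
    by rewrite coprimep_sym coprimep_expl // irreducible_poly_coprime.
  rewrite dvdp1 => /size_poly1P[c c0 ec].
  apply/eqP; rewrite -dvdp1; apply: dvdp_trans (dvdp_mulr (t \Po - 'X) (dvdpp t)) _.
  by rewrite -even_odd_normE ec comp_polyC dvdp1 size_polyC c0.
have [e|/dvdpP[a ea]] : size g = 1%N \/ Q %| even_odd_norm g.
  by apply: dich; rewrite -normM dvdp_mulr.
  by rewrite e in g1.
have [/eqP/size_poly1P[c c0 ec]|/dvdpP[b eb]] :
    size h = 1%N \/ Q %| even_odd_norm h.
  by apply: dich; rewrite -normM dvdp_mull.
  by rewrite eP ec mul_polyC eqp_sym eqp_scale.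
have ab : a * b = 1.
  have : Q ^+ 2 != 0 by rewrite expf_neq0.
  by move/mulIf; apply; rewrite mul1r -[RHS]normM ea eb; ring.
have /size_poly1P[c c0 ac] : size a == 1%N by rewrite -dvdp1 -ab dvdp_mulr.
have evalN x : (even_poly g).[x] ^+ 2 - x * (odd_poly g).[x] ^+ 2 = c * Q.[x].
  rewrite -(hornerC c x) -hornerM -ac -ea /even_odd_norm hornerD hornerN.
  by rewrite horner_exp hornerM horner_exp hornerX.
have c_gt0 : 0 < c.
  have := evalN 0; rewrite mul0r subr0 => e.
  by rewrite lt0r c0 -(pmulr_lge0 _ Q0) -e sqr_ge0.
have := evalN (- v); rewrite mulNr opprK => e.
have : c * Q.[- v] < 0 by rewrite pmulr_rlt0.
by rewrite -e ltNge addr_ge0 ?sqr_ge0 ?(mulr_ge0 v0) ?sqr_ge0.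
Qed.

(** A monic integer polynomial has no non-unit constant factor, so
    irreducibility over the rationals suffices. *)
Lemma irreducible_elt_int (p : {poly int}) : p \is monic ->
  irreducible_poly (map_poly (intr : int -> rat) p) -> irreducible_elt p.
Proof.
move=> mp [sp irrp]; rewrite size_map_poly_id0 in sp; last first.
  by rewrite intr_eq0 (monicP mp) oner_neq0.
have unit1 (q r : {poly int}) : p = q * r -> size q = 1%N -> q \is a GRing.unit.
  move=> e q1; have := congr1 lead_coef e; rewrite lead_coefM (monicP mp) => l1.
  rewrite poly_unitE q1 eqxx /=; apply/unitrPr; exists (lead_coef r).
  by rewrite l1 (lead_coefE q) q1.
split=> [||y z e].
- by rewrite -size_poly_gt0 ltnW.
- by rewrite poly_unitE negb_and (gtn_eqF sp).
have [/eqP y1|y1] := boolP (size y == 1%N); first by left; apply: unit1 e y1.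
right; apply: (unit1 z y); first by rewrite mulrC.
have := irrp (map_poly intr y); rewrite size_rat_int_poly => /(_ y1).
rewrite dvdp_rat_int e dvdp_mulr // => /(_ isT)/eqp_size; rewrite !size_rat_int_poly.
have p0 : y * z != 0 by rewrite -e -size_poly_gt0 ltnW.
have /andP[y0 z0] : (y != 0) && (z != 0) by rewrite -negb_or -mulf_eq0.
rewrite size_mul // => e'.
have sy : (0 < size y)%N by rewrite size_poly_gt0.
have sz : (0 < size z)%N by rewrite size_poly_gt0.
by case: (size y) (size z) sy sz e' => [|n] [|k] // _ _; lia.
Qed.

(** * The cuboid polynomial *)

(** Expansion of (x^2 - p^2)^2 + 6 D x (x^2 - p^2) + D^2 x^2. *)
Definition cuboid_quartic {R : nzRingType} (p D : R) : {poly R} :=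
  'X^4 + (6 * D) *: 'X^3 + (D ^+ 2 - 2 * p ^+ 2) *: 'X^2
  + (- (6 * D * p ^+ 2)) *: 'X + (p ^+ 4)%:P.

(** A root x gives (x^2 - p^2 + 3 D x)^2 = 8 D^2 x^2. A splitting into quadratics
    makes 32 D^2 a square or gives a rational point on the curve of
    [sqr8_sqr9_rat] with nonzero ordinate. *)
Lemma irreducible_cuboid_quartic (p D : rat) : p != 0 -> D != 0 ->
  irreducible_poly (cuboid_quartic p D).
Proof.
move=> p0 D0; apply: irreducible_quartic => [x e|b c d e e3 e2 e1 e0].
  have /sqr_eq_double_sqr_rat/eqP :
      (x ^+ 2 - p ^+ 2 + 3 * D * x) ^+ 2 = 2 * (2 * D * x) ^+ 2.
    by apply: subr0_eq; rewrite -[RHS]e; ring.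
  rewrite !mulf_eq0 (negbTE D0) /= => /eqP x0.
  move: e; rewrite x0 !expr0n /= !mulr0 !add0r => /eqP.
  by rewrite expf_eq0 (negbTE p0).
have Dd : d = 6 * D - b by rewrite -e3; ring.
have : (c + p ^+ 2) * (b * p ^+ 2 + d * c) = 0.
  have -> : (c + p ^+ 2) * (b * p ^+ 2 + d * c)
    = c * (b * e + c * d + p ^+ 2 * (b + d)) - b * (c * e - p ^+ 4) by ring.
  by rewrite e0 e1 e3; ring.
move/eqP; rewrite mulf_eq0 => /orP[/eqP cp|/eqP bd].
  have ec : c = - p ^+ 2 by apply/eqP; rewrite -addr_eq0 cp.
  have ee : e = - p ^+ 2.
    apply: (@mulfI _ (p ^+ 2)); first by rewrite expf_neq0.
    apply: oppr_inj; rewrite -mulNr -ec e0 ec; ring.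
  have /sqr_eq_double_sqr_rat/eqP : (b - d) ^+ 2 = 2 * (4 * D) ^+ 2.
    have -> : (b - d) ^+ 2 = (b + d) ^+ 2 - 4 * (c + e + b * d - (c + e)) by ring.
    by rewrite e2 e3 ec ee; ring.
  by rewrite mulf_eq0 (negbTE D0).
have c0 : c != 0.
  by apply: contra_eq_neq e0 => ->; rewrite mul0r eq_sym expf_neq0.
(* Since b (c - p^2) = 6 D c and d (c - p^2) = - 6 D p^2, multiplying the
   coefficient equation e2 by c (c - p^2)^2 eliminates b and d. *)
have N : (c - e) ^+ 2 = D ^+ 2 * (c + e + 34 * p ^+ 2).
  have bc : b * (c - p ^+ 2) = 6 * D * c.
    by rewrite -e3 -[LHS]addr0 -bd; ring.
  have dc : d * (c - p ^+ 2) = - (6 * D * p ^+ 2).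
    by rewrite -e3 -[RHS]addr0 -bd; ring.
  have bdc : (b * d) * (c - p ^+ 2) ^+ 2 = - (36 * D ^+ 2 * p ^+ 2 * c).
    have -> : (b * d) * (c - p ^+ 2) ^+ 2
      = (b * (c - p ^+ 2)) * (d * (c - p ^+ 2)) by ring.
    by rewrite bc dc; ring.
  apply: (@mulfI _ (c ^+ 2)); first by rewrite expf_neq0.
  have -> : c ^+ 2 * (c - e) ^+ 2 = (c ^+ 2 - c * e) ^+ 2 by ring.
  have -> : c ^+ 2 * (D ^+ 2 * (c + e + 34 * p ^+ 2))
    = c * D ^+ 2 * (c ^+ 2 + c * e + 34 * p ^+ 2 * c) by ring.
  rewrite e0.
  have -> : (c ^+ 2 - p ^+ 4) ^+ 2
    = (c ^+ 2 + p ^+ 4 + 2 * p ^+ 2 * c) * (c - p ^+ 2) ^+ 2 by ring.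
  rewrite -e0.
  have -> : (c ^+ 2 + c * e + 2 * p ^+ 2 * c) * (c - p ^+ 2) ^+ 2
    = c * ((c + e + b * d + 2 * p ^+ 2) * (c - p ^+ 2) ^+ 2
           - (b * d) * (c - p ^+ 2) ^+ 2) by ring.
  by rewrite bdc e2 e0; ring.
(* X = m / (2 p) turns the next equation into the one of sqr8_sqr9_rat. *)
pose m := (c - e) / D.
have em : c + e + 34 * p ^+ 2 = m ^+ 2.
  by rewrite expr_div_n N mulrAC mulfV ?mul1r // expf_neq0.
have quart : (m ^+ 2 - 32 * p ^+ 2) * (m ^+ 2 - 36 * p ^+ 2) = (D * m) ^+ 2.
  have -> : D * m = c - e by rewrite mulrC divfK.
  have -> : (c - e) ^+ 2 = (c + e) ^+ 2 - 4 * (c * e) by ring.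
  by rewrite -em e0; ring.
have /sqr8_sqr9_rat w0 : ((m / (2 * p)) ^+ 2 - 8) * ((m / (2 * p)) ^+ 2 - 9)
    = (D * m / (4 * p ^+ 2)) ^+ 2.
  rewrite [RHS]expr_div_n -quart; field; exact: p0.
have m0 : m = 0.
  apply: (mulfI D0); rewrite mulr0 -(@divfK _ (4 * p ^+ 2) _ (D * m)) ?w0.
    by rewrite mul0r.
  by rewrite mulf_neq0 // expf_neq0.
move: quart; rewrite m0 => quart.
have p4 : p ^+ 4 = 0 by move: quart; rewrite mulr0 expr0n /=; lra.
by move/eqP: p4; rewrite expf_eq0 (negbTE p0).
Qed.

Lemma cuboid_poly_ratE (a u : nat) :
  map_poly intr (cuboid_poly a u)
  = cuboid_quartic (a%:R * u%:R : rat) (u%:R ^+ 2 - a%:R ^+ 2) \Po 'X^2.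
Proof.
have mapE (c6 c4 c2 c0 : int) : map_poly (intr : int -> rat)
    ('X^8 + c6%:P * 'X^6 + c4%:P * 'X^4 - c2%:P * 'X^2 + c0%:P)
    = 'X^8 + c6%:~R%:P * 'X^6 + c4%:~R%:P * 'X^4 - c2%:~R%:P * 'X^2 + c0%:~R%:P.
  rewrite !mul_polyC 3!rmorphD rmorphN /= rmorphD /= !map_polyZ.
  by rewrite !map_polyXn map_polyC.
rewrite mapE /cuboid_quartic.
rewrite !comp_polyD !comp_polyZ comp_polyC !comp_Xn_poly comp_polyX -!exprM.
rewrite -!mul_polyC polyCN mulNr /cuboid_Delta.
congr (_ + _%:P * _ + _%:P * _ - _%:P * _ + _%:P).
- by rewrite !(rmorphM, rmorphB, rmorphXn).
- by rewrite !(rmorphM, rmorphB, rmorphXn) /=; ring.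
- by rewrite !(rmorphM, rmorphB, rmorphXn) /=; ring.
- by rewrite !(rmorphM, rmorphB, rmorphXn) /=; ring.
Qed.

Lemma monic_cuboid_poly (a u : nat) : cuboid_poly a u \is monic.
Proof.
have sz c n : (n <= 6)%N -> (size (c%:P * 'X^n : {poly int})%R < 8.+1)%N.
  move=> n6; rewrite mul_polyC (leq_ltn_trans (size_scale_leq _ _)) //.
  by rewrite size_polyXn ltnS; lia.
rewrite monicE /cuboid_poly -!addrA lead_coefDl ?lead_coefXn //.
rewrite size_polyXn.
do 3!rewrite (leq_ltn_trans (size_polyD _ _)) // gtn_max ?size_polyN ?sz //=.
by rewrite (leq_ltn_trans (size_polyC_leq1 _)).
Qed.

(** At x = - u^2 one has x^2 - p^2 = u^2 (u^2 - a^2) = - D x, so the form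
    Y^2 + 6 Y D x + (D x)^2 takes the value (1 - 6 + 1) (D x)^2. *)
Lemma cuboid_quartic_at_sqr (a u : rat) :
  (cuboid_quartic (a * u) (u ^+ 2 - a ^+ 2)).[- u ^+ 2]
  = - (4 * (u ^+ 2 - a ^+ 2) ^+ 2 * (u ^+ 2) ^+ 2).
Proof.
rewrite !(hornerD, hornerZ, hornerXn, hornerX, hornerC); ring.
Qed.

Lemma irreducible_cuboid_poly_rat (a u : nat) :
  (0 < a)%N -> (0 < u)%N -> a <> u ->
  irreducible_poly (map_poly (intr : int -> rat) (cuboid_poly a u)).
Proof.
move=> a0 u0 au; rewrite cuboid_poly_ratE.
have a0' : (a%:R : rat) != 0 by rewrite pnatr_eq0 -lt0n.
have u0' : (u%:R : rat) != 0 by rewrite pnatr_eq0 -lt0n.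
have D0 : (u%:R ^+ 2 - a%:R ^+ 2 : rat) != 0.
  rewrite subr_sqr mulf_neq0 //; last by rewrite -natrD pnatr_eq0; lia.
  by rewrite subr_eq0 eqr_nat eq_sym; apply/eqP.
apply: (@irreducible_comp_X2 _ _ (u%:R ^+ 2)).
- by apply: irreducible_cuboid_quartic => //; rewrite mulf_neq0.
- rewrite !(hornerD, hornerZ, hornerXn, hornerX, hornerC) !expr0n /= !mulr0 !add0r.
  by rewrite exprn_even_gt0 //= mulf_neq0.
- exact: sqr_ge0.
- rewrite cuboid_quartic_at_sqr oppr_lt0 mulr_gt0 //.
    by rewrite mulr_gt0 // exprn_even_gt0 //= D0.
  by rewrite exprn_even_gt0 //= expf_neq0.
Qed.

Local Close Scope ring_scope.

Theorem theorem8 (a u : nat) (ha : 0 < a) (hu : 0 < u)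
  (hcop : coprime a u) (hne : a <> u) :
  irreducible_elt (cuboid_poly a u).
Proof.
apply: irreducible_elt_int; first exact: monic_cuboid_poly.
exact: irreducible_cuboid_poly_rat.
Qed.
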